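(* Let $M=\begin{pmatrix}1&0\\-1&1\end{pmatrix}$, $N=\begin{pmatrix}1&0\\0&1\end{pmatrix}$, and define $\tau_1,\tau_2:S_2\to\mathbb N$ by $\tau_1=2\mu_1+\mu_2$ and $\tau_2=\mu_1+2\mu_2$. (1) If $p_1,p_2$ are any idempotents in $\beta\mathbb N$, $B_1\in p_1$, $B_2\in p_2$, $F$ is a finite set of $S_0$-preserving homomorphisms from $S_2$ to $S_0$, and $D$ is a piecewise syndetic subset of $S_0$, then there exists $w\in S_2$ such that $M\begin{pmatrix}\tau_1(w)\\ \tau_2(w)\end{pmatrix}\in B_1\times B_2$ and $\nu(w)\in D$ for each $\nu\in F$. (2) There exist idempotents $p_1,p_2$ in $\beta\mathbb N$ and sets $B_1\in p_1$, $B_2\in p_2$ for which there does not exist $w\in S_2$ with $N\begin{pmatrix}\tau_1(w)\\ \tau_2(w)\end{pmatrix}\in B_1\times B_2$.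
   Context: $\mathbb A$ is a fixed nonempty finite alphabet, $S_0=\mathbb A^+$ the free semigroup of nonempty words over $\mathbb A$, and $S_2$ the set of nonempty words over $\mathbb A\cup\{v_1,v_2\}$ (with $v_1,v_2\notin\mathbb A$ distinct) in which both $v_1$ and $v_2$ occur. $\mu_j(w)=|w|_{v_j}$ is the number of occurrences of $v_j$ in $w$. A homomorphism $\nu:S_2\to S_0$ is $S_0$-preserving if $\nu(uw)=u\nu(w)$ and $\nu(wu)=\nu(w)u$ for all $u\in S_0,w\in S_2$. $\beta\mathbb N$ is the Stone–Čech compactification of $(\mathbb N,+)$ with extended operation ($A\in p+q$ iff $\{x:-x+A\in q\}\in p$). For a discrete semigroup $X$, $K(\beta X)$ is the smallest ideal of $\beta X$ and $D\subseteq X$ is piecewise syndetic if $D\in p$ for some $p\in K(\beta X)$. *)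

(* Defs.v *)
From HB Require Import structures.
From mathcomp Require Import all_boot all_order all_algebra.
From mathcomp Require Import boolp classical_sets functions cardinality filter.

Set Implicit Arguments.
Unset Strict Implicit.
Unset Printing Implicit Defensive.

Import Order.TTheory GRing.Theory.

Local Open Scope classical_set_scope.

Record beta (X : Type) := Beta {
  beta_mem :> set X -> Prop ;
  beta_ultra : UltraFilter beta_mem }.

Section BetaOp.
Context {X : Type} (op : X -> X -> X).

(* [set y | A (op x y)] is x^-1 A, or -x + A in additive notation. *)
Definition beta_op_sets (p q : set_system X) : set_system X :=
  [set A | p [set x | q [set y | A (op x y)]]].

Lemma beta_op_ultra (p q : beta X) : UltraFilter (beta_op_sets p q).
Proof.
have pU := beta_ultra p; have qU := beta_ultra q.
have PF : ProperFilter (beta_op_sets p q).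
  split; last split; rewrite /beta_op_sets /=.
  - by move=> p0; apply: (filter_not_empty (beta_mem p)); apply: filterS p0 => x /filter_not_empty.
  - by apply: (filterS _ (@filterT _ (beta_mem p) _)) => x _; exact: filterT.
  - move=> P Q pP pQ; apply: (filterS _ (@filterI _ (beta_mem p) _ _ _ pP pQ)) => x [qP qQ].
    exact: (@filterI _ (beta_mem q) _ _ _ qP qQ).
  - by move=> P Q PQ; apply: filterS => x; apply: filterS => y; exact: PQ.
split=> // G GF pG; apply/seteqP; split=> // A GA.
have [//|pA] := in_ultra_setVsetC [set x | q [set y | A (op x y)]] pU.
exfalso; apply: (filter_not_empty G); rewrite -(setICr A).
apply: filterI => //; apply: pG; apply: filterS pA => x nqA.
by have [|] := in_ultra_setVsetC [set y | A (op x y)] qU.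
Qed.

Definition beta_op (p q : beta X) : beta X := Beta (beta_op_ultra p q).

End BetaOp.

HB.instance Definition _ (X : magmaType) :=
  hasMul.Build (beta X) (beta_op (fun x y : X => (x * y)%g)).
HB.instance Definition _ (X : baseAddMagmaType) :=
  GRing.hasAdd.Build (beta X) (beta_op (fun x y : X => (x + y)%R)).

Section SmallestIdeal.
Context {X : semigroupType}.

Definition beta_ideal (I : set (beta X)) : Prop :=
  I !=set0 /\ forall p q : beta X, I p -> I (p * q)%g /\ I (q * p)%g.

(* The intersection of all two-sided ideals; as [beta X] has a smallest
   two-sided ideal, this is that ideal. *)
Definition K_beta : set (beta X) :=
  [set p | forall I : set (beta X), beta_ideal I -> I p].

Definition piecewise_syndetic (D : set X) : Prop :=
  exists2 p : beta X, K_beta p & p D.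

End SmallestIdeal.

Record posnat := Posnat { posnat_val :> nat ; posnat_gt0 : (0 < posnat_val)%N }.

HB.instance Definition _ := [isSub for posnat_val].
HB.instance Definition _ := [Choice of posnat by <:].

Lemma posnat_add_subproof (m n : posnat) : (0 < m + n)%N.
Proof. by rewrite addn_gt0 posnat_gt0. Qed.

Definition posnat_add (m n : posnat) : posnat := Posnat (posnat_add_subproof m n).

Lemma posnat_addC : commutative posnat_add.
Proof. by move=> m n; apply: val_inj; rewrite /= addnC. Qed.

Lemma posnat_addA : associative posnat_add.
Proof. by move=> m n k; apply: val_inj; rewrite /= addnA. Qed.

HB.instance Definition _ :=
  GRing.isAddSemigroup.Build posnat posnat_addC posnat_addA.

Section Words.
Context (A : finType).

Record S0 := Word0 { word0 :> seq A ; word0_neq0 : word0 != [::] }.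

HB.instance Definition _ := [isSub for word0].
HB.instance Definition _ := [Choice of S0 by <:].

Lemma S0_mul_subproof (u v : S0) : u ++ v != [::] :> seq A.
Proof. by case: u => -[|a s]. Qed.

Definition S0_mul (u v : S0) : S0 := Word0 (S0_mul_subproof u v).

Lemma S0_mulA : associative S0_mul.
Proof. by move=> u v w; apply: val_inj; rewrite /= catA. Qed.

HB.instance Definition _ := isSemigroup.Build S0 S0_mulA.

(* The letters [inl a] are those of the alphabet; the variables v_1 and v_2 are
   [inr ord0] and [inr ord_max]. *)
Definition letter : Type := (A + 'I_2)%type.

Definition is_S2 (w : seq letter) : bool :=
  (w != [::]) && [forall j : 'I_2, inr j \in w].

Record S2 := Word2 { word2 :> seq letter ; word2_S2 : is_S2 word2 }.

HB.instance Definition _ := [isSub for word2].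
HB.instance Definition _ := [Choice of S2 by <:].

Lemma is_S2_catl (s w : seq letter) : is_S2 w -> is_S2 (s ++ w).
Proof.
case/andP=> w0 /forallP wv; apply/andP; split; first by case: s.
by apply/forallP => j; rewrite mem_cat wv orbT.
Qed.

Lemma is_S2_catr (w s : seq letter) : is_S2 w -> is_S2 (w ++ s).
Proof.
case/andP=> w0 /forallP wv; apply/andP; split; first by case: w w0 {wv}.
by apply/forallP => j; rewrite mem_cat wv.
Qed.

Definition S2_mul (v w : S2) : S2 :=
  Word2 (is_S2_catl v (word2_S2 w)).

Lemma S2_mulA : associative S2_mul.
Proof. by move=> u v w; apply: val_inj; rewrite /= catA. Qed.

HB.instance Definition _ := isSemigroup.Build S2 S2_mulA.

Definition S0_letters (u : S0) : seq letter := [seq inl a | a <- u].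

Definition lact (u : S0) (w : S2) : S2 :=
  Word2 (is_S2_catl (S0_letters u) (word2_S2 w)).

Definition ract (w : S2) (u : S0) : S2 :=
  Word2 (is_S2_catr (S0_letters u) (word2_S2 w)).

Definition S0_preserving_hom (nu : S2 -> S0) : Prop :=
  [/\ forall v w : S2, nu (v * w)%g = (nu v * nu w)%g,
      forall (u : S0) (w : S2), nu (lact u w) = (u * nu w)%g &
      forall (u : S0) (w : S2), nu (ract w u) = (nu w * u)%g].

Definition mu (j : 'I_2) (w : S2) : nat := count_mem (inr j : letter) w.

Definition mu1 (w : S2) : nat := mu ord0 w.
Definition mu2 (w : S2) : nat := mu ord_max w.

Lemma mu_gt0 (j : 'I_2) (w : S2) : (0 < mu j w)%N.
Proof. by rewrite -has_count has_pred1; case/andP: (word2_S2 w) => _ /forallP. Qed.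

Lemma tau1_subproof (w : S2) : (0 < 2 * mu1 w + mu2 w)%N.
Proof. by rewrite addn_gt0 (mu_gt0 ord_max w) orbT. Qed.

Lemma tau2_subproof (w : S2) : (0 < mu1 w + 2 * mu2 w)%N.
Proof. by rewrite addn_gt0 (mu_gt0 ord0 w). Qed.

Definition tau1 (w : S2) : posnat := Posnat (tau1_subproof w).
Definition tau2 (w : S2) : posnat := Posnat (tau2_subproof w).

End Words.

Definition mx2 (a b c d : int) : 'M[int]_2 :=
  \matrix_(i, j) if i == ord0 then (if j == ord0 then a else b)
                 else (if j == ord0 then c else d).

Definition col2 (x y : int) : 'cV[int]_2 := \col_i if i == ord0 then x else y.

Definition posnat_col (m n : posnat) : 'cV[int]_2 :=
  col2 (Posz m) (Posz n).

(* B1 x B2, as a set of integer column vectors. *)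
Definition posnat_setX (B1 B2 : set posnat) : set 'cV[int]_2 :=
  [set posnat_col b.1 b.2 | b in B1 `*` B2].

(* Main.v *)
Require Import Defs.
From mathcomp Require Import all_boot all_order all_algebra.
From mathcomp Require Import boolp classical_sets functions cardinality filter.
From mathcomp Require Import zify.

(* Part (1).  As [p1] and [p2] are idempotent, the ultrafilters on S2 whose
   images under [tau1] and [tau2 - tau1] are [p1] and [p2] form a compact
   semigroup J, which is nonempty because every idempotent of beta N contains
   the multiples of 3.  Words over the alphabet do not change [tau1] and [tau2],
   so beta S0 acts on J from both sides; given a minimal idempotent e of beta S0,
   Ellis' theorem in J e then yields an idempotent q of J with e q = q = q e.
   Every S0-preserving nu maps q to an idempotent below e, that is, to e itself,
   and D has a translate in some such e.
   Part (2).  [tau1 w / tau2 w] always lies strictly between 1/2 and 2, whereas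
   this fails for quotients of elements of the union of the [16^k, 2 * 16^k) by
   elements of the union of the [4 * 16^k, 8 * 16^k); both unions belong to
   idempotents. *)

Set Implicit Arguments.
Unset Strict Implicit.
Unset Printing Implicit Defensive.

Import GRing.Theory.

Local Open Scope classical_set_scope.

#[local] Existing Instance beta_ultra.

(** * Ultrafilters and the Stone topology on [beta X] *)

Lemma ultra_of_setC X (F : set_system X) :
  ProperFilter F -> (forall A, F A \/ F (~` A)) -> UltraFilter F.
Proof.
move=> PF FC; split=> // G GF FG; apply/seteqP; split=> // A GA.
have [//|/FG nA] := FC A.
by exfalso; apply: (@filter_not_empty _ G _); rewrite -(setICr A); exact: filterI.
Qed.

Section BetaSpace.
Context {X : Type}.
Implicit Types (p q : beta X) (A B : set X) (C D : set (beta X)).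

Lemma beta_ext p q : (forall A, p A -> q A) -> p = q.
Proof.
case: p q => [p pU] [q qU] /= pq.
have epq : q = p by exact: (@max_filter _ p pU q _ pq).
by subst q; congr Beta; exact: Prop_irrelevance.
Qed.

Lemma beta_setC p A : p A \/ p (~` A).
Proof. exact: in_ultra_setVsetC. Qed.

Lemma beta_disjoint p A : p A -> p (~` A) -> False.
Proof.
by move=> pA pnA; apply: (@filter_not_empty _ p _); rewrite -(setICr A); exact: filterI.
Qed.

Lemma beta_extend (F : set_system X) :
  ProperFilter F -> exists p, forall A, F A -> p A.
Proof. by move=> /ultraFilterLemma[p [pU Fp]]; exists (Beta pU) => A /Fp. Qed.

(* Closedness in the Stone topology, whose basic open sets are the [set p | p A]. *)
Definition beta_closed C : Prop :=
  forall p, (forall A, p A -> exists2 q, C q & q A) -> C p.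

Lemma beta_closedI C D : beta_closed C -> beta_closed D -> beta_closed (C `&` D).
Proof.
move=> Cc Dc p pCD; split; [apply: Cc|apply: Dc] => A /pCD[q [Cq Dq] qA];
  by exists q.
Qed.

Lemma beta_closed_bigcap (G : set (set (beta X))) :
  (forall C, G C -> beta_closed C) -> beta_closed (\bigcap_(C in G) C).
Proof.
move=> Gc p pG C GC; apply: Gc => // A /pG[q qG qA]; exists q => //; exact: qG.
Qed.

Lemma beta_closed_mem A : beta_closed [set p | p A].
Proof.
move=> p pA; have [//|/pA[q qA qnA]] := beta_setC p A.
by case: (beta_disjoint qA qnA).
Qed.

(** The sets that belong to every point of some member of [G] form a proper filter, and an
    ultrafilter extending it lies in the closure of each member of [G]. *)
Lemma beta_compact (G : set (set (beta X))) :
  G !=set0 -> (forall C, G C -> beta_closed C /\ C !=set0) ->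
  (forall C D, G C -> G D -> exists2 E, G E & E `<=` C `&` D) ->
  \bigcap_(C in G) C !=set0.
Proof.
move=> [C0 GC0] Gc Gdir.
pose F : set_system X := [set A | exists2 C, G C & forall q, C q -> q A].
have FP : ProperFilter F.
  split; last split.
  - move=> [C /Gc[_ [q Cq]] /(_ q Cq)]; exact: filter_not_empty.
  - by exists C0 => // q _; exact: filterT.
  - move=> A B [C GC CA] [D GD DB]; have [E GE EI] := Gdir _ _ GC GD.
    by exists E => // q /EI[/CA qA /DB qB]; exact: filterI.
  - by move=> A B AB [C GC CA]; exists C => // q /CA; exact: filterS.
have [p Fp] := beta_extend FP.
exists p => C GC; apply: (Gc _ GC).1 => A pA; apply: contrapT => nA.
apply: (@beta_disjoint p A) => //; apply: Fp; exists C => // q Cq.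
by have [qA|//] := beta_setC q A; case: nA; exists q.
Qed.

(** [Q] is abstract so that one Zorn argument serves closed subsemigroups and closed left ideals
    alike. *)
Lemma beta_minimal_closed (Q : set (set (beta X))) C0 :
  (forall G, G `<=` Q -> Q (\bigcap_(C in G) C)) ->
  beta_closed C0 -> C0 !=set0 -> Q C0 ->
  exists C, [/\ C `<=` C0, beta_closed C, C !=set0, Q C &
    forall D, D `<=` C -> beta_closed D -> D !=set0 -> Q D -> D = C].
Proof.
move=> Qcap C0c C00 QC0.
(* Zorn is applied to the part [U] cut out of [C0]: a maximal [U] leaves a minimal closed set. *)
pose P U := [/\ beta_closed (C0 `\` U), C0 `\` U !=set0 & Q (C0 `\` U)].
have [F FP Ftot|U [[cU U0 QU] Umax]] := @Zorn_bigcup _ P.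
  (* Including [C0] keeps [G] nonempty even for the empty chain. *)
  pose G := [set C | C = C0 \/ exists2 U, F U & C = C0 `\` U].
  have GP C : G C -> [/\ beta_closed C, C !=set0 & Q C].
    by case=> [->//|[U /FP[? ? ?] ->]].
  have Geq : \bigcap_(C in G) C = C0 `\` \bigcup_(U in F) U.
    apply/seteqP; split=> [p Gp|p [C0p nFp] C].
      split; first by apply: Gp; left.
      move=> [U FU Up]; have [//|_ /(_ Up)//] := Gp (C0 `\` U).
      by right; exists U.
    case=> [->//|[U FU ->]]; split=> // Up; apply: nFp; by exists U.
  rewrite /P -Geq; split.
  - by apply: beta_closed_bigcap => C /GP[].
  - apply: beta_compact; [by exists C0; left|by move=> C /GP[]|].
    move=> C D [->|[U FU ->]] [->|[V FV ->]].
    + by exists C0 => //; left.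
    + by exists (C0 `\` V); [right; exists V|move=> p []; split].
    + by exists (C0 `\` U); [right; exists U|move=> p []; split].
    + have [UV|VU] := Ftot _ _ FU FV.
        exists (C0 `\` V); first by right; exists V.
        by move=> p [C0p Vp]; split; split=> // /UV.
      exists (C0 `\` U); first by right; exists U.
      by move=> p [C0p Vp]; split; split=> // /VU.
  - by apply: Qcap => C /GP[].
exists (C0 `\` U); split=> // D DC Dc D0 QD.
have eD : C0 `\` ~` D = D.
  apply/seteqP; split=> [p [_ /contrapT]//|p Dp]; split; last exact.
  by case: (DC _ Dp).
apply/seteqP; split=> // p [C0p Up]; apply: contrapT => nDp.
apply: (Umax (~` D)); last by rewrite /P eD.
split; first by move=> q Uq /DC[].
by move/(_ _ nDp).
Qed.

End BetaSpace.

(** The clopen sets of a Stone space [beta X] are exactly the basic ones, so this is ordinary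
    continuity. *)
Definition beta_continuous X Y (f : beta X -> beta Y) : Prop :=
  forall A, exists B, forall p, f p A <-> p B.

Section BetaContinuous.
Context {X Y : Type} (f : beta X -> beta Y) (fc : beta_continuous f).

(** For [z] in the closure of the image, the sets of points of [C] whose image contains [A], for [A]
    in [z], are closed, nonempty and directed; by compactness they share a point, and it is mapped
    to [z]. *)
Lemma beta_closed_image (C : set (beta X)) :
  beta_closed C -> beta_closed (f @` C).
Proof.
move=> Cc z zfC.
pose G := [set D | exists2 A, z A & D = C `&` [set p | f p A]].
have [||D1 D2 [A zA ->] [B zB ->]|p Gp] := @beta_compact _ G.
- by exists (C `&` [set p | f p setT]), setT; first exact: filterT.
- move=> D [A zA ->]; split; last first.
    by have [_ [p Cp <-] fpA] := zfC _ zA; exists p.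
  apply: beta_closedI => //; have [B fB] := fc A.
  by move=> p pA; apply/fB; apply: beta_closed_mem => E /pA[q /fB qB]; exists q.
- exists (C `&` [set p | f p (A `&` B)]).
    by exists (A `&` B) => //; exact: filterI.
  move=> p [Cp fpAB]; split; split=> //=; apply: filterS fpAB; by move=> y [].
have Cp : C p.
  have [|//] := Gp (C `&` [set p | f p setT]).
  by exists setT => //; exact: filterT.
exists p => //; apply/esym/beta_ext => A zA.
by have [|_] := Gp (C `&` [set p | f p A]); first by exists A.
Qed.

Lemma beta_closed_fiber (z : beta Y) : beta_closed [set p | f p = z].
Proof.
move=> p pz; apply/esym/beta_ext => A zA.
have [//|] := beta_setC (f p) A; have [B fB] := fc (~` A).
by move=> /fB/pz[q qz /fB qnA]; case: (@beta_disjoint _ z A); rewrite // -qz.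
Qed.

End BetaContinuous.

(** * Products and images of ultrafilters *)

Section BetaProduct.
Context {X Y Z : Type} (op : X -> Y -> Z).

(** Three types are allowed so that the actions [lact] and [ract] extend to ultrafilters in the same
    way as the multiplications. *)
Definition beta_prod_sets (p : beta X) (q : beta Y) : set_system Z :=
  [set A | p [set x | q [set y | A (op x y)]]].

Lemma beta_prod_ultra p q : UltraFilter (beta_prod_sets p q).
Proof.
apply: ultra_of_setC => [|A].
  split; last split; rewrite /beta_prod_sets /=.
  - move=> p0; apply: (@filter_not_empty _ p _); apply: filterS p0 => x.
    exact: filter_not_empty.
  - by apply: (@filterS _ p _ _ _ _ (@filterT _ p _)) => x _; exact: filterT.
  - move=> P Q pP pQ; apply: (@filterS _ p _ _ _ _ (@filterI _ p _ _ _ pP pQ)) => x [qP qQ].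
    exact: (@filterI _ q _ _ _ qP qQ).
  - by move=> P Q PQ; apply: filterS => x; apply: filterS => y; exact: PQ.
have [|pA] := beta_setC p [set x | q [set y | A (op x y)]]; first by left.
right; apply: filterS pA => x nqA.
by have [|] := beta_setC q [set y | A (op x y)].
Qed.

Definition beta_prod p q : beta Z := Beta (beta_prod_ultra p q).

Lemma beta_prod_continuous q : beta_continuous (beta_prod^~ q).
Proof. by move=> A; exists [set x | q [set y | A (op x y)]]. Qed.

End BetaProduct.

Lemma beta_prodA X Y Z XY YZ T (op1 : XY -> Z -> T) (op2 : X -> Y -> XY)
    (op3 : X -> YZ -> T) (op4 : Y -> Z -> YZ) :
  (forall x y z, op1 (op2 x y) z = op3 x (op4 y z)) ->
  forall p q r, beta_prod op1 (beta_prod op2 p q) r =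
                beta_prod op3 p (beta_prod op4 q r).
Proof.
move=> opA p q r; apply: beta_ext => A; rewrite /= /beta_prod_sets /=.
by apply: filterS => x; apply: filterS => y; apply: filterS => z; rewrite /= opA.
Qed.

Section BetaMap.
Context {X Y : Type} (f : X -> Y).

Lemma beta_map_ultra (p : beta X) : UltraFilter [set A | p (f @^-1` A)].
Proof.
by apply: ultra_of_setC => A; exact: beta_setC.
Qed.

Definition beta_map p : beta Y := Beta (beta_map_ultra p).

End BetaMap.

Lemma beta_map_prod X Y Z X' Y' Z' (f : Z -> Z') (g : X -> X') (h : Y -> Y')
    (op : X -> Y -> Z) (op' : X' -> Y' -> Z') :
  (forall x y, f (op x y) = op' (g x) (h y)) ->
  forall p q, beta_map f (beta_prod op p q) =
              beta_prod op' (beta_map g p) (beta_map h q).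
Proof.
move=> fop p q; apply: beta_ext => A; rewrite /= /beta_prod_sets /=.
by apply: filterS => x; apply: filterS => y; rewrite /= fop.
Qed.

Lemma beta_map_id X (p : beta X) : beta_map id p = p.
Proof. exact: beta_ext. Qed.

(** * Idempotents and minimal left ideals *)

Section Ellis.
Context {X : Type} (op : X -> X -> X) (opA : associative op).
Local Notation "p ** q" := (beta_prod op p q) (at level 40, left associativity).
Implicit Types (p q : beta X) (C L : set (beta X)).

Let prodA p q r : (p ** q) ** r = p ** (q ** r).
Proof. by apply: beta_prodA => x y z; rewrite opA. Qed.

(** In a minimal closed subsemigroup [D] with [e] in [D], minimality gives [D ** e = D]. Hence the
    [p] in [D] with [p ** e = e] form a nonempty closed subsemigroup, which is all of [D] and so
    contains [e]. *)
Lemma ellis_idempotent C :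
  beta_closed C -> C !=set0 -> (forall p q, C p -> C q -> C (p ** q)) ->
  exists2 e, C e & e ** e = e.
Proof.
move=> Cc C0 CM.
pose Q C := forall p q, C p -> C q -> C (p ** q).
have [|D [DC Dc [e De] DM Dmin]] := @beta_minimal_closed _ Q C _ Cc C0 CM.
  move=> G GQ p q Gp Gq D GD; exact: GQ (Gp _ GD) (Gq _ GD).
exists e; first exact: DC.
have De_D : (fun p => p ** e) @` D = D.
  apply: Dmin.
  - by move=> _ [p Dp <-]; exact: DM.
  - by apply: beta_closed_image => //; exact: beta_prod_continuous.
  - by exists (e ** e), e.
  - move=> _ _ [p Dp <-] [q Dq <-]; exists (p ** e ** q); last by rewrite !prodA.
    by apply: (DM) => //; exact: DM.
have : (D `&` [set p | p ** e = e]) = D.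
  apply: Dmin.
  - by move=> p [].
  - apply: beta_closedI => //; apply: (@beta_closed_fiber _ _ (beta_prod op ^~ e)).
    exact: beta_prod_continuous.
  - by move: De; rewrite -{1}De_D => -[p Dp pe]; exists p.
  - move=> p q [Dp /= pe] [Dq /= qe]; split; first exact: DM.
    by rewrite /= prodA qe.
by move=> DE; move: De; rewrite -{1}DE => -[].
Qed.

Definition beta_left_ideal L : Prop := forall p q, L q -> L (p ** q).

(** For [a] in a minimal closed left ideal, the multiples [c ** a] form a closed left ideal inside
    it, hence all of it. *)
Lemma minimal_left_ideal_exists p :
  exists L, [/\ beta_closed L, L !=set0, beta_left_ideal L &
    forall a b, L a -> L b -> exists c, b = c ** a].
Proof.
have [||||L [_ Lc L0 LI Lmin]] := @beta_minimal_closed _ beta_left_ideal setT.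
- by move=> G GI q r Gr D GD; exact: GI (Gr _ GD).
- by [].
- by exists p.
- by [].
exists L; split=> // a b La.
have <- : (fun c => c ** a) @` setT = L => [|[c _ <-]]; last by exists c.
apply: Lmin.
- by move=> _ [c _ <-]; exact: LI.
- by apply: beta_closed_image => //; exact: beta_prod_continuous.
- by exists (a ** a), a.
- by move=> c _ [d _ <-]; exists (c ** d) => //; rewrite prodA.
Qed.

End Ellis.

(** * Minimal idempotents and the smallest ideal *)

Section MinimalIdempotent.
Context {X : semigroupType}.
Implicit Types p q e : beta X.

Lemma beta_mulE p q : (p * q)%g = beta_prod (fun x y : X => (x * y)%g) p q.
Proof. exact: beta_ext. Qed.

Lemma beta_mulA p q r : (p * (q * r) = (p * q) * r)%g.
Proof. by rewrite !beta_mulE; apply/esym/beta_prodA => x y z; rewrite mulgA. Qed.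

(** The point [p] lies in some translate [L s] of a minimal left ideal [L]. Each element of [L s]
    again generates it, so an idempotent of [L s] is a right identity there and is minimal. *)
Lemma K_beta_idempotent p : K_beta p ->
  exists e, [/\ (e * e = e)%g, (p * e = p)%g &
    forall q, (q * q = q)%g -> (e * q = q)%g -> (q * e = q)%g -> q = e].
Proof.
move=> Kp.
have [L [Lc [a La] LI Lmin]] := minimal_left_ideal_exists (@mulgA X) p.
have {LI}LI q r : L r -> L (q * r)%g by rewrite beta_mulE; exact: LI.
have {}Lmin b c : L b -> L c -> exists d, (c = d * b)%g.
  by move=> Lb Lc'; have [d ->] := Lmin _ _ Lb Lc'; exists d; rewrite beta_mulE.
(* The products [l * s] with [l] in [L] form a two-sided ideal, so [K_beta] is contained in it. *)
have [l Ll [s ->]] : exists2 l, L l & exists s, (p = l * s)%g.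
  apply: (Kp [set p | exists2 l, L l & exists s, (p = l * s)%g]); split.
    by exists (a * a)%g, a => //; exists a.
  move=> _ q [l Ll [s ->]]; split.
    by exists l => //; exists (s * q)%g; rewrite beta_mulA.
  by exists (q * l)%g; [exact: LI|exists s; rewrite beta_mulA].
pose L' := (fun r => (r * s)%g) @` L.
have L'c : beta_closed L'.
  apply: beta_closed_image => // A; exists [set x | s [set y | A (x * y)%g]].
  by [].
have L'I q r : L' r -> L' (q * r)%g.
  by move=> [b Lb <-]; exists (q * b)%g; [exact: LI|rewrite beta_mulA].
have L'min b c : L' b -> L' c -> exists d, (c = d * b)%g.
  move=> [b' Lb' <-] [c' Lc' <-]; have [d ->] := Lmin _ _ Lb' Lc'.
  by exists d; rewrite beta_mulA.
have L'ls : L' (l * s)%g by exists l.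
have [||e L'e] := @ellis_idempotent _ _ (@mulgA X) L' L'c.
- by exists (l * s)%g.
- by move=> q r _ L'r; rewrite -beta_mulE; exact: L'I.
rewrite -beta_mulE => ee; exists e; split=> //.
  by have [d ->] := L'min _ _ L'e L'ls; rewrite -beta_mulA ee.
move=> q qq e_q qe; have L'q : L' q by rewrite -qe; exact: L'I.
(* From [e = d * q] and [q * q = q] follows [e * q = e], while [e * q = q] by assumption. *)
have [d ed] := L'min q e L'q L'e.
by rewrite -e_q {1}ed -beta_mulA qq -ed.
Qed.

End MinimalIdempotent.

(** * Size and divisibility in idempotents of beta N *)

Section PosnatIdempotent.
Variable p : beta posnat.
Hypothesis pp : (p + p = p)%R.

Lemma idempotent_gt m : p [set x : posnat | (m < x)%N].
Proof.
elim: m => [|m IHm].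
  by apply: (@filterS _ p _ setT); [move=> x _; exact: posnat_gt0|exact: filterT].
have: (p + p)%R [set x : posnat | (m.+1 < x)%N]; last by rewrite pp.
have pT : p setT by exact: filterT.
apply: (@filterS _ p _ setT _ _ pT) => x _; apply: filterS IHm => y /= my.
by have := posnat_gt0 x; lia.
Qed.

(** Some residue class [r] modulo [d] belongs to [p]. As [p + p = p], there is an [x] in this class
    such that [x + y] is in it for [p]-many [y], and such [y] are divisible by [d]. *)
Lemma idempotent_dvdn d : (0 < d)%N -> p [set x : posnat | (d %| x)%N].
Proof.
move=> d0; have [r pr] : exists r, p [set x : posnat | (x %% d)%N = r].
  apply: contrapT => npr.
  (* If no class belonged to [p], the residues 0, 1, 2, ... could be excluded in turn until none
     below [d] is left. *)
  have pge k : p [set x : posnat | (k <= x %% d)%N].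
    elim: k => [|k IHk].
      by apply: (@filterS _ p _ setT); [move=> x _|exact: filterT].
    have [pk|pk] := beta_setC p [set x : posnat | (x %% d)%N = k].
      by case: npr; exists k.
    apply: (@filterS _ p _ _ _ _ (@filterI _ p _ _ _ IHk pk)) => x [/= kx xk].
    by rewrite ltn_neqAle kx andbT; apply/eqP => /esym.
  apply: (@filter_not_empty _ p _); apply: filterS (pge d) => x /=.
  by rewrite leqNgt ltn_mod d0.
have pr' : p [set x : posnat | p [set y : posnat | ((x + y) %% d)%N = r]].
  by move: pr; rewrite -{1}pp.
have [x [/= xr]] := @filter_ex _ p _ _ (@filterI _ p _ _ _ pr pr').
apply: filterS => y /=; rewrite -xr -{2}[x : nat]addn0 => /eqP.
by rewrite eqn_modDl mod0n.
Qed.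

End PosnatIdempotent.

(** * Variable words and the counts of their variables *)

Section VariableWords.
Context {A : finType}.
Implicit Types (v w : S2 A) (u : S0 A) (B : set posnat).

Lemma mu_mul j v w : mu j (v * w)%g = (mu j v + mu j w)%N.
Proof. by rewrite /mu /= count_cat. Qed.

Lemma mu_letters j u : count_mem (inr j : letter A) (S0_letters u) = 0%N.
Proof. by rewrite /S0_letters count_map; elim: (word0 u). Qed.

Lemma mu_lact j u w : mu j (lact u w) = mu j w.
Proof. by rewrite /mu /= count_cat mu_letters. Qed.

Lemma mu_ract j w u : mu j (ract w u) = mu j w.
Proof. by rewrite /mu /= count_cat mu_letters addn0. Qed.

Lemma S2_mu_exists a b : (0 < a)%N -> (0 < b)%N ->
  exists w : S2 A, mu1 w = a /\ mu2 w = b.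
Proof.
move=> a0 b0.
pose s : seq (letter A) := nseq a (inr ord0) ++ nseq b (inr ord_max).
have ws : is_S2 s.
  apply/andP; split; first by rewrite /s; case: (a) a0.
  apply/forallP => j; rewrite mem_cat !mem_nseq a0 b0 /=.
  by case: j => -[|[|//]] ?; apply/orP; [left|right]; apply/eqP; congr inr;
    exact: val_inj.
exists (Word2 ws); split; rewrite /mu1 /mu2 /mu /= count_cat !count_nseq /=.
  by rewrite mul1n mul0n addn0.
by rewrite mul1n mul0n.
Qed.

(* The condition on [(tau1 w, tau2 w - tau1 w)], free of subtraction. *)
Definition tau_in B1 B2 : set (S2 A) :=
  [set w | B1 (tau1 w) /\ exists2 b : posnat, B2 b & (tau1 w + b)%N = tau2 w].

Lemma tau_in_sub B1 B2 C1 C2 : B1 `<=` C1 -> B2 `<=` C2 ->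
  tau_in B1 B2 `<=` tau_in C1 C2.
Proof. by move=> BC1 BC2 w [/BC1 ? [b /BC2 ? ?]]; split=> //; exists b. Qed.

Lemma tau_in_congr B1 B2 v w : mu1 v = mu1 w -> mu2 v = mu2 w ->
  tau_in B1 B2 v -> tau_in B1 B2 w.
Proof.
move=> e1 e2.
have t1 : tau1 v = tau1 w by apply: val_inj; rewrite /= e1 e2.
have t2 : tau2 v = tau2 w by apply: val_inj; rewrite /= e1 e2.
by move=> [B1v [b B2b vb]]; split; [|exists b => //]; rewrite -?t1 -?t2.
Qed.

(** * The compact semigroup of ultrafilters on S2 above [p1] and [p2] *)

Section TauUltrafilters.
Variables p1 p2 : beta posnat.
Hypotheses (pp1 : (p1 + p1 = p1)%R) (pp2 : (p2 + p2 = p2)%R).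

Definition tau_beta : set (beta (S2 A)) :=
  [set r | forall B1 B2, p1 B1 -> p2 B2 -> r (tau_in B1 B2)].

Lemma tau_beta_closed : beta_closed tau_beta.
Proof.
move=> r rT B1 B2 pB1 pB2; apply: beta_closed_mem => C /rT[q qT qC].
by exists q => //; exact: qT.
Qed.

(* [2 mu1 + mu2 = b1] and [mu2 - mu1 = b2] amount to [3 mu1 = b1 - b2], and every
   idempotent contains the multiples of 3. *)
Lemma tau_in_nonempty B1 B2 : p1 B1 -> p2 B2 -> tau_in B1 B2 !=set0.
Proof.
move=> pB1 pB2.
have [b2 [B2b2 /= /dvdnP[k2 k2E]]] := @filter_ex _ p2 _ _
  (@filterI _ p2 _ _ _ pB2 (idempotent_dvdn pp2 (isT : (0 < 3)%N))).
(* Requiring [b1] to exceed [b2] makes [k1 - k2] positive, so that both variables can occur. *)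
have [b1 [[B1b1 /= /dvdnP[k1 k1E]] /= b12]] := @filter_ex _ p1 _ _
  (@filterI _ p1 _ _ _ (@filterI _ p1 _ _ _ pB1 (idempotent_dvdn pp1 (isT : (0 < 3)%N)))
    (idempotent_gt pp1 b2)).
have [||w [w1 w2]] := @S2_mu_exists (k1 - k2) (k1 - k2 + b2); [lia|lia|].
exists w; split.
  suff -> : tau1 w = b1 by [].
  by apply: val_inj; rewrite /= w1 w2; lia.
by exists b2 => //=; rewrite w1 w2; lia.
Qed.

Lemma tau_beta_nonempty : tau_beta !=set0.
Proof.
pose D := [set B : set posnat * set posnat | p1 B.1 /\ p2 B.2].
have [|r rF] := @beta_extend _
    (filter_from D (fun B : set posnat * set posnat => tau_in B.1 B.2)).
  apply: filter_from_proper; last by move=> [B1 B2] [/= ? ?]; exact: tau_in_nonempty.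
  apply: filter_from_filter.
    by exists (setT, setT); split; exact: filterT.
  move=> [B1 B2] [C1 C2] [/= pB1 pB2] [/= pC1 pC2].
  exists (B1 `&` C1, B2 `&` C2) => /=.
    by split; [exact: (@filterI _ p1 _)|exact: (@filterI _ p2 _)].
  by move=> w Ww; split; apply: tau_in_sub Ww => x [].
by exists r => B1 B2 pB1 pB2; apply: rF; exists (B1, B2).
Qed.

(** Both [tau1] and [tau2 - tau1] are additive, so they send the product to [p1 + p1] and
    [p2 + p2]. *)
Lemma tau_beta_mul q r :
  tau_beta q -> tau_beta r -> tau_beta (beta_prod (fun v w => (v * w)%g) q r).
Proof.
move=> qT rT B1 B2; rewrite -{1}pp1 -{1}pp2 => pB1 pB2.
apply: filterS (qT _ _ pB1 pB2) => v [/= B1v [b /= B2b vb]].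
apply: filterS (rT _ _ B1v B2b) => w [/= B1vw [c B2bc wc]].
split; last first.
  exists (b + c)%R => //; move: vb wc; rewrite /= /mu1 /mu2 !mu_mul; lia.
suff -> : tau1 (v * w)%g = (tau1 v + tau1 w)%R by [].
by apply: val_inj; rewrite /= /mu1 /mu2 !mu_mul; lia.
Qed.

Lemma tau_beta_lact (e : beta (S0 A)) r :
  tau_beta r -> tau_beta (beta_prod (@lact A) e r).
Proof.
move=> rT B1 B2 pB1 pB2.
apply: (@filterS _ e _ setT); last exact: filterT.
move=> u _; apply: filterS (rT _ _ pB1 pB2) => w /=.
by apply: tau_in_congr; rewrite /mu1 /mu2 mu_lact.
Qed.

Lemma tau_beta_ract (e : beta (S0 A)) r :
  tau_beta r -> tau_beta (beta_prod (@ract A) r e).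
Proof.
move=> rT B1 B2 pB1 pB2.
apply: filterS (rT _ _ pB1 pB2) => w ww.
apply: (@filterS _ e _ setT); last exact: filterT.
by move=> u _; apply: tau_in_congr ww; rewrite /mu1 /mu2 mu_ract.
Qed.

(** Products are continuous in the left factor, which makes J e closed; J e is also a semigroup. An
    idempotent [r] of J e satisfies r e = r, and q = e r works: (e r)(e r) = e ((r e) r) = e (r r) =
    e r. *)
Lemma tau_beta_idempotent_below (e : beta (S0 A)) : (e * e = e)%g ->
  exists q, [/\ tau_beta q, beta_prod (fun v w => (v * w)%g) q q = q,
    beta_prod (@lact A) e q = q & beta_prod (@ract A) q e = q].
Proof.
rewrite beta_mulE => ee.
pose mul2 := fun v w : S2 A => (v * w)%g.
have ractK r : beta_prod (@ract A) (beta_prod (@ract A) r e) e = beta_prod (@ract A) r e.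
  rewrite -{3}ee; apply: beta_prodA => w x y; apply: val_inj => /=.
  by rewrite /S0_letters map_cat catA.
have lactK r : beta_prod (@lact A) e (beta_prod (@lact A) e r) = beta_prod (@lact A) e r.
  rewrite -{3}ee; apply/esym/beta_prodA => x y w; apply: val_inj => /=.
  by rewrite /S0_letters map_cat catA.
have mul_ract q r : beta_prod (@ract A) (beta_prod mul2 q r) e =
    beta_prod mul2 q (beta_prod (@ract A) r e).
  by apply: beta_prodA => v w x; apply: val_inj; rewrite /= catA.
have mul_lact q r : beta_prod mul2 (beta_prod (@lact A) e q) r =
    beta_prod (@lact A) e (beta_prod mul2 q r).
  by apply: beta_prodA => v w x; apply: val_inj; rewrite /= catA.
have lact_ract r : beta_prod (@ract A) (beta_prod (@lact A) e r) e =
    beta_prod (@lact A) e (beta_prod (@ract A) r e).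
  by apply: beta_prodA => x w y; apply: val_inj; rewrite /= catA.
have mulA : associative mul2 by move=> x y z; exact: mulgA.
have [r [r' r'T r'e] rr] : exists2 r, ((fun r => beta_prod (@ract A) r e) @` tau_beta) r &
    beta_prod mul2 r r = r.
  apply: (ellis_idempotent mulA).
  - by apply: beta_closed_image tau_beta_closed; exact: beta_prod_continuous.
  - by have [r rT] := tau_beta_nonempty; exists (beta_prod (@ract A) r e), r.
  - move=> _ _ [q qT <-] [r rT <-].
    exists (beta_prod mul2 (beta_prod (@ract A) q e) r); last exact: mul_ract.
    by apply: tau_beta_mul => //; exact: tau_beta_ract.
have re : beta_prod (@ract A) r e = r by rewrite -r'e ractK.
have rT : tau_beta r by rewrite -r'e; exact: tau_beta_ract.
exists (beta_prod (@lact A) e r); split.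
- exact: tau_beta_lact.
- rewrite mul_lact; congr beta_prod.
  rewrite -{1}re.
  have -> : beta_prod mul2 (beta_prod (@ract A) r e) (beta_prod (@lact A) e r) =
     beta_prod mul2 (beta_prod (@ract A) (beta_prod (@ract A) r e) e) r.
    by apply/esym/beta_prodA => v x w; apply: val_inj; rewrite /= catA.
  by rewrite !re.
- exact: lactK.
- by rewrite lact_ract re.
Qed.

End TauUltrafilters.
End VariableWords.

(** * Images under homomorphisms, finite intersections and matrix entries *)

Lemma preserving_hom_beta (A : finType) (nu : S2 A -> S0 A) q (e : beta (S0 A)) :
  S0_preserving_hom nu ->
  (forall q', (q' * q' = q')%g -> (e * q' = q')%g -> (q' * e = q')%g -> q' = e) ->
  beta_prod (fun v w => (v * w)%g) q q = q ->
  beta_prod (@lact A) e q = q -> beta_prod (@ract A) q e = q ->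
  beta_map nu q = e.
Proof.
move=> [nuM nuL nuR] emin qq eq_q qe_q; apply: emin.
- by rewrite beta_mulE -[in RHS]qq; apply/esym/beta_map_prod.
- by rewrite beta_mulE -{1}[e]beta_map_id -[in RHS]eq_q; apply/esym/beta_map_prod.
- by rewrite beta_mulE -{1}[e]beta_map_id -[in RHS]qe_q; apply/esym/beta_map_prod.
Qed.

Lemma beta_finite_bigcap X (p : beta X) (I : choiceType) (F : set I) (B : I -> set X) :
  finite_set F -> (forall i, F i -> p (B i)) ->
  p [set x | forall i, F i -> B i x].
Proof.
move=> /finite_fsetP[E ->] pB; apply: (@filter_bigI _ _ _ _ p _) => i iE.
exact: pB.
Qed.

Lemma mulmx2_col2 a b c d x y :
  (mx2 a b c d *m col2 x y = col2 (a * x + b * y) (c * x + d * y))%R.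
Proof.
apply/matrixP => i j; rewrite !mxE !big_ord_recl big_ord0 !mxE /= addr0.
by case: ifP.
Qed.

Lemma col2_inj a b c d : col2 a b = col2 c d -> a = c /\ b = d.
Proof.
move=> /matrixP E; have := E ord0 ord0; have := E ord_max ord0.
by rewrite !mxE /=.
Qed.

(** * Idempotents determined by leading base 16 digits *)

Section LeadingInterval.
Variable c : nat.
Hypotheses (c_gt0 : (0 < c)%N) (c_le8 : (2 * c <= 16)%N).

(** As [2 * c <= 16], these are the numbers whose leading base 16 digit lies in [c, 2c). *)
Definition leading_interval : set posnat :=
  [set x | exists k, (c * 16 ^ k <= x < 2 * c * 16 ^ k)%N].

(* Divisibility by [16 ^ n] makes the addition of smaller numbers carry-free. *)
Definition leading_beta : set (beta posnat) :=
  [set p | forall n, p [set x | leading_interval x /\ (16 ^ n %| x)%N]].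

(** If [n <= k], then [y] and the bound [2 * c * 16 ^ k] are both multiples of [16 ^ n], so the gap
    between them exceeds [x]. If [k < n], then [y] would be a positive multiple of [16 ^ n] below
    [16 ^ n]. *)
Lemma leading_intervalD n (x y : posnat) : (x < 16 ^ n)%N ->
  leading_interval y -> (16 ^ n %| y)%N -> leading_interval (x + y)%R.
Proof.
move=> xn [k /andP[ky yk]] ny; exists k; apply/andP; split=> /=.
  exact: leq_trans ky (leq_addl _ _).
have [nk|kn] := leqP n k; last first.
  have: (2 * c * 16 ^ k <= 16 ^ n)%N.
    by apply: leq_trans (leq_pexp2l _ kn) => //; rewrite expnS leq_mul2r c_le8 orbT.
  move=> h; have := dvdn_leq (posnat_gt0 y) ny; lia.
have /dvdnP[s sE] : (16 ^ n %| 2 * c * 16 ^ k)%N by rewrite dvdn_mull // dvdn_exp2l.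
move: yk; have /dvdnP[t ->] := ny; rewrite sE ltn_pmul2r ?expn_gt0 // => ts.
have : (t.+1 * 16 ^ n <= s * 16 ^ n)%N by rewrite leq_mul2r ts orbT.
rewrite mulSn; lia.
Qed.

Lemma leading_idempotent :
  exists p : beta posnat, (p + p = p)%R /\ p leading_interval.
Proof.
have [||p q pL qL n|p pL pp] := @ellis_idempotent _ _ posnat_addA leading_beta.
- move=> p pL n; apply: beta_closed_mem => B /pL[q qL qB].
  by exists q => //; exact: qL.
- have [|p pF] := @beta_extend _ (filter_from setT
    (fun n => [set x : posnat | leading_interval x /\ (16 ^ n %| x)%N])).
    apply: filter_from_proper; last first.
      move=> n _; have c16 : (0 < c * 16 ^ n)%N by rewrite muln_gt0 c_gt0 expn_gt0.
      exists (Posnat c16); split; last exact: dvdn_mull.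
      by exists n; rewrite /= leqnn /= -mulnA ltn_Pmull.
    apply: filter_from_filter; first by exists 0%N.
    move=> m n _ _; exists (maxn m n) => // x [xL mnx]; split; split=> //.
      by apply: dvdn_trans mnx; rewrite dvdn_exp2l // leq_maxl.
    by apply: dvdn_trans mnx; rewrite dvdn_exp2l // leq_maxr.
  by exists p => n; apply: pF; exists n.
- apply: filterS (pL n) => x [_ nx].
  (* The exponent [n + x] serves twice: [16 ^ (n + x)] exceeds [x] and is a multiple of [16 ^ n]. *)
  apply: filterS (qL (n + x)%N) => y [yL nxy]; split.
    apply: leading_intervalD nxy => //.
    by apply: leq_trans (ltn_expl _ (isT : 1 < 16)%N) _; rewrite leq_pexp2l // leq_addl.
  apply: dvdn_add => //; apply: dvdn_trans nxy; by rewrite dvdn_exp2l // leq_addr.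
exists p; split; last by apply: filterS (pL 0%N) => x [].
by rewrite -[RHS]pp; exact: beta_ext.
Qed.

End LeadingInterval.

(** The blocks [1, 2), [4, 8), [16, 32), [64, 128), ... belong alternately to the two sets, and
    consecutive ones are a factor of 2 apart. *)
Lemma leading_interval_ratio (x y : posnat) :
  leading_interval 1 x -> leading_interval 4 y ->
  (2 * x < y)%N \/ (2 * y < x)%N.
Proof.
move=> [k /andP[kx xk]] [j /andP[jy yj]]; have [kj|jk] := leqP k j.
  have : (16 ^ k <= 16 ^ j)%N by rewrite leq_pexp2l.
  by left; lia.
have : (16 ^ j.+1 <= 16 ^ k)%N by rewrite leq_pexp2l.
by rewrite expnS; right; lia.
Qed.

Local Open Scope ring_scope.

Theorem theorem2p13 (A : finType) (hA : (0 < #|A|)%N) :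
  let M := mx2 1 0 (-1) 1 in
  let N := mx2 1 0 0 1 in
  (forall (p1 p2 : beta posnat) (B1 B2 : set posnat)
          (F : set (S2 A -> S0 A)) (D : set (S0 A)),
     p1 + p1 = p1 -> p2 + p2 = p2 -> p1 B1 -> p2 B2 ->
     finite_set F -> (forall nu, F nu -> S0_preserving_hom nu) ->
     piecewise_syndetic D ->
     exists w : S2 A,
       posnat_setX B1 B2 (M *m posnat_col (tau1 w) (tau2 w)) /\
       forall nu, F nu -> D (nu w)) /\
  (exists (p1 p2 : beta posnat) (B1 B2 : set posnat),
     [/\ p1 + p1 = p1, p2 + p2 = p2, p1 B1, p2 B2 &
         ~ exists w : S2 A,
             posnat_setX B1 B2 (N *m posnat_col (tau1 w) (tau2 w))]).
Proof.
move=> M N; split.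
  move=> p1 p2 B1 B2 F D pp1 pp2 pB1 pB2 Ffin Fhom [p Kp pD].
  have [e [ee pe emin]] := K_beta_idempotent Kp.
  have [q [qT qq eq_q qe_q]] := @tau_beta_idempotent_below A _ _ pp1 pp2 _ ee.
  (* Since [p * e = p], the set [D] belongs to [p * e], so some translate of it belongs to [e]. *)
  have [x ex] : exists x, e [set y | D (x * y)%g].
    by apply: (@filter_ex _ p _); move: pD; rewrite -{1}pe.
  have qD : q [set w | forall nu, F nu -> D (x * nu w)%g].
    apply: beta_finite_bigcap => // nu /Fhom nuhom.
    by move: ex; rewrite -(preserving_hom_beta nuhom emin qq eq_q qe_q).
  have [w [[B1w [b B2b wb]] Dw]] :=
    @filter_ex _ q _ _ (@filterI _ q _ _ _ (qT _ _ pB1 pB2) qD).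
  (* Prefixing [x] leaves both counts unchanged and turns [nu w] into [x * nu w]. *)
  exists (lact x w); split; last first.
    by move=> nu Fnu; have [_ -> _] := Fhom _ Fnu; exact: Dw.
  exists (tau1 w, b) => //; rewrite /posnat_col mulmx2_col2 /=.
  move: wb; rewrite /= /mu1 /mu2 !mu_lact => wb; congr col2; lia.
have [p1 [pp1 p1B]] := @leading_idempotent 1 isT isT.
have [p2 [pp2 p2B]] := @leading_idempotent 4 isT isT.
exists p1, p2, (leading_interval 1), (leading_interval 4).
split=> // -[w [[b1 b2] [/= B1 B2]]].
rewrite /posnat_col mulmx2_col2 => /col2_inj[b1w b2w].
(* Positivity of both counts makes [tau2 w < 2 * tau1 w] and [tau1 w < 2 * tau2 w] strict. *)
have w1 := mu_gt0 ord0 w; have w2 := mu_gt0 ord_max w.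
have := leading_interval_ratio B1 B2; move: b1w b2w; rewrite /= /mu1 /mu2; lia.
Qed.
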